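(* (i) There exists a universal constant $C>0$ such that for every irreducible, reversible and lazy Markov chain on a finite state space, $$t_{\mathrm{mix}}\le C\,t_{\mathrm I}.$$ (ii) There exist universal constants $c,C>0$ such that for every lazy weighted random walk on a finite tree, $$c\,t_{\mathrm I}\le t_{\mathrm{mix}}\le C\,t_{\mathrm I}.$$
   Context: All chains are in discrete time. A chain is lazy if its transition matrix has the form $(P+I)/2$ for some stochastic matrix $P$, where $I$ is the identity matrix. Let $\pi$ be the stationary distribution and $p_t(x,\cdot)$ the $t$-step transition probabilities of the lazy chain. Mixing time: $t_{\mathrm{mix}}=\min\{t\ge 0:\max_x\|p_t(x,\cdot)-\pi\|_{\mathrm{TV}}\le 1/4\}$. Intersection time: let $X,Y$ be two independent chains with the given (lazy) transition matrix and let $\tau_I=\inf\{t\ge 0:\{X_0,\ldots,X_t\}\cap\{Y_0,\ldots,Y_t\}\ne\varnothing\}$. Then $t_{\mathrm I}=\max_{x,y}\mathbb{E}_{x,y}[\tau_I]$, where $\mathbb{E}_{x,y}$ is expectation when $X_0=x$, $Y_0=y$. Weighted random walk on a tree: each edge $\{u,v\}$ carries a weight $c(u,v)=c(v,u)>0$, and the (non-lazy) walk moves from $u$ to a neighbour $v$ with probability $c(u,v)/\sum_{w\sim u}c(u,w)$; the lazy weighted walk has transition matrix $(P+I)/2$ where $P$ is this transition matrix. On a one-vertex tree the walk stays put. *)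

(* Defs.v *)
From HB Require Import structures.
From mathcomp Require Import all_boot all_order all_algebra.
From mathcomp Require Import all_classical all_reals all_analysis.

Set Implicit Arguments.
Unset Strict Implicit.
Unset Printing Implicit Defensive.

Import Order.TTheory GRing.Theory Num.Theory.

Local Open Scope classical_set_scope.
Local Open Scope ring_scope.

Section FiniteChains.
Context {R : realType} {S : finType}.
Implicit Types (P : S -> S -> R) (mu nu pi : S -> R).

Definition distribution_on mu : Prop :=
  (forall x, 0 <= mu x) /\ \sum_(x : S) mu x = 1.

Definition stochastic P : Prop := forall x, distribution_on (P x).

Definition lazy_version P : S -> S -> R :=
  fun x y => (P x y + (x == y)%:R) / 2.

Definition is_lazy P : Prop :=
  exists2 Q, stochastic Q & forall x y, P x y = lazy_version Q x y.

Fixpoint step_prob P (t : nat) (x y : S) : R :=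
  if t is t'.+1 then \sum_(z : S) step_prob P t' x z * P z y
  else (x == y)%:R.

Definition irreducible_chain P : Prop :=
  forall x y, exists t, 0 < step_prob P t x y.

Definition stationary P pi : Prop :=
  distribution_on pi /\ forall y, \sum_(x : S) pi x * P x y = pi y.

Definition detailed_balance P pi : Prop :=
  forall x y, pi x * P x y = pi y * P y x.

Definition tv_dist mu nu : R :=
  \big[Num.max/0]_(A : {set S}) `|\sum_(x in A) mu x - \sum_(x in A) nu x|.

(* The infimum in the extended reals: +oo if no such t exists. *)
Definition t_mix P pi : \bar R :=
  ereal_inf [set t%:R%:E | t in
    [set t : nat | \big[Num.max/0]_(x : S) tv_dist (step_prob P t x) pi
                     <= 1 / 4]].

End FiniteChains.

Section IntersectionTime.
Context {R : realType} {S : finType} {d : measure_display}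
        {Omega : measurableType d}.
Implicit Types (Pr : probability Omega R) (X Y : nat -> Omega -> S).

Definition is_chain Pr X (P : S -> S -> R) (x0 : S) : Prop :=
  [/\ forall n (B : set S), measurable (X n @^-1` B),
      Pr (X 0%N @^-1` [set x0]) = 1%E
    & forall (n : nat) (u : nat -> S) (y : S),
        let past := [set w | forall i, (i <= n)%N -> X i w = u i] in
        Pr (past `&` X n.+1 @^-1` [set y]) = (Pr past * (P (u n) y)%:E)%E].

Definition sigma_process X : set (set Omega) :=
  <<s [set A | exists n (B : set S), A = X n @^-1` B] >>.

Definition independent_processes Pr X Y : Prop :=
  forall A B, sigma_process X A -> sigma_process Y B ->
    Pr (A `&` B) = (Pr A * Pr B)%E.

Definition visited X (t : nat) (w : Omega) : set S :=
  [set X i w | i in [set i | (i <= t)%N]].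

(* +oo if the two trajectories never meet *)
Definition tau_I X Y (w : Omega) : \bar R :=
  ereal_inf [set t%:R%:E | t in
    [set t : nat | visited X t w `&` visited Y t w !=set0]].

(* [Prxy x y] is the law under which X and Y are independent chains with
   transition matrix P, started at x and at y: it is the measure written
   P_{x,y}, whose expectation is E_{x,y}. *)
Definition independent_chains (P : S -> S -> R)
    (Prxy : S -> S -> probability Omega R) X Y : Prop :=
  forall x y, [/\ is_chain (Prxy x y) X P x, is_chain (Prxy x y) Y P y
                & independent_processes (Prxy x y) X Y].

Definition t_I (Prxy : S -> S -> probability Omega R) X Y : \bar R :=
  \big[maxe/-oo%E]_(x : S) \big[maxe/-oo%E]_(y : S)
    (\int[Prxy x y]_w tau_I X Y w)%E.

End IntersectionTime.

Section WeightedTrees.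
Context {R : realType} {V : finType}.
Implicit Types (e : rel V) (c : V -> V -> R).

Definition is_tree e : Prop :=
  [/\ (0 < #|V|)%N, symmetric e, irreflexive e,
      forall u v, connect e u v
    & forall s : seq V, (2 < size s)%N -> ~ ucycle e s].

(* Only the values of c on edges matter. *)
Definition edge_weights e c : Prop :=
  forall u v, e u v -> 0 < c u v /\ c u v = c v u.

Definition weighted_walk e c : V -> V -> R := fun u v =>
  if #|V| == 1%N then (u == v)%:R
  else if e u v then c u v / \sum_(w | e u w) c u w else 0.

End WeightedTrees.

(* Main.v *)
Require Import Defs.
From HB Require Import structures.
From mathcomp Require Import all_boot all_order all_algebra.
From mathcomp Require Import ring lra.
From mathcomp Require Import all_classical all_reals all_analysis.
From mathcomp Require Import measurable_realfun.

(* Upper bound on the mixing time.  Let [C_L] be the average of [P^k] over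
   [k < L] and suppose [C_L(x, A) < pi(A) - delta].  For [f = C_L 1_A] one has
   [|P f - f| <= 1/L], so up to an error [t/L] both [f (X_k)] and [1 - f (Y_k)]
   are supermartingales for [k <= t].  If [Y] starts at a maximum of [f] (where
   [f >= pi(A)]) and [X] at [x], the maximal inequality keeps, with probability
   bounded below, [X] in [{f < pi(A) - delta/2}] and [Y] in its complement up to
   a time [t] of order [L]; the paths are then disjoint.  Hence averaging over a
   time of order [t_I] brings the chain close to [pi].  For a lazy reversible
   chain this gives mixing at time [2L]: [n |-> <g, P^n g>] is nonnegative,
   nonincreasing and convex, so in L^2(pi) the oscillation of [s |-> P^s g] on
   [L <= s <= 2L] is bounded by [<g, P^L g>], and a chain stopped at a uniform
   time [k < L], hence close to stationarity, sees almost the same value of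
   [P^(2L-k) g] whatever [k] is.

   Lower bound on trees.  Let [o] be a vertex all of whose branches have mass at
   most 1/2.  Starting in a branch, the chain must visit [o] in order to leave
   it, and at a mixing time it is outside the branch with probability at least
   1/4; so [o] is hit after at most [4 t_mix] steps in mean.  Both chains have
   visited [o] by the maximum of the two hitting times, whence
   [t_I <= 8 t_mix]. *)

Set Implicit Arguments.
Unset Strict Implicit.
Unset Printing Implicit Defensive.

Import Order.TTheory GRing.Theory Num.Theory.

Local Open Scope ring_scope.

(** * Markov operators and reversibility *)

Section MarkovOperator.
Context {R : realType} {S : finType}.
Implicit Types (P Q : S -> S -> R) (f g : S -> R).

Definition act P f : S -> R := fun x => \sum_y P x y * f y.

Lemma iter_actE P n f x :
  iter n (act P) f x = \sum_y step_prob P n x y * f y.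
Proof.
elim: n f => [|n IH] f.
  rewrite (bigD1 x) //= eqxx mul1r big1 ?addr0// => y yx.
  by rewrite eq_sym (negbTE yx) mul0r.
rewrite iterSr IH /act.
under eq_bigr do rewrite mulr_sumr.
rewrite exchange_big; apply: eq_bigr => y _ /=.
by rewrite mulr_suml; apply: eq_bigr => z _; rewrite mulrA.
Qed.

Lemma step_probD P m n x y :
  step_prob P (m + n) x y = \sum_z step_prob P m x z * step_prob P n z y.
Proof.
elim: n y => [|n IH] y.
  rewrite addn0 (bigD1 y) //= eqxx mulr1 big1 ?addr0// => z zy.
  by rewrite (negbTE zy) mulr0.
rewrite addnS /=; under eq_bigr do rewrite IH mulr_suml.
rewrite exchange_big; apply: eq_bigr => z _ /=.
by rewrite mulr_sumr; apply: eq_bigr => w _; rewrite mulrA.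
Qed.

Lemma actB P f g : act P (fun x => f x - g x) = fun x => act P f x - act P g x.
Proof.
by apply/funext => x; rewrite /act -sumrB; apply: eq_bigr => y _; rewrite mulrBr.
Qed.

Lemma iter_actB P n f g :
  iter n (act P) (fun x => f x - g x) =
  fun x => iter n (act P) f x - iter n (act P) g x.
Proof. by elim: n => //= n ->; rewrite actB. Qed.

Lemma step_prob_ge0 P n x y :
  (forall x y, 0 <= P x y) -> 0 <= step_prob P n x y.
Proof.
by move=> P0; elim: n y => [|n IH] y /=; rewrite ?ler0n// sumr_ge0// => z _;
  rewrite mulr_ge0.
Qed.

Lemma step_prob_stochastic P n : stochastic P -> stochastic (step_prob P n).
Proof.
move=> Ps x; split=> [y|]; first by apply: step_prob_ge0 => a b; case: (Ps a).
transitivity (iter n (act P) (fun=> 1) x).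
  by rewrite iter_actE; apply: eq_bigr => y _; rewrite mulr1.
suff -> : iter n (act P) (fun=> 1) = fun=> 1 by [].
elim: n => //= n ->; apply/funext => y; rewrite /act.
by under eq_bigr do rewrite mulr1; case: (Ps y).
Qed.

Lemma lazy_stochastic Q : stochastic Q -> stochastic (lazy_version Q).
Proof.
move=> Qs x; have [Q0 Q1] := Qs x; split=> [y|].
  by rewrite divr_ge0// addr_ge0// ler0n.
rewrite -mulr_suml big_split /= Q1 (bigD1 x)//= eqxx big1 ?addr0.
  by rewrite divff.
by move=> y yx; rewrite eq_sym (negbTE yx).
Qed.

Lemma is_lazy_stochastic P : is_lazy P -> stochastic P.
Proof.
case=> Q Qs PQ; suff -> : P = lazy_version Q by exact: lazy_stochastic.
by apply/funext => x; apply/funext => y.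
Qed.

(** The law of the chain at an independent uniform time [k < L]. *)
Definition time_average P L : S -> S -> R :=
  fun x y => (\sum_(k < L) step_prob P k x y) / L%:R.

Lemma act_cesaroE P L f x :
  act (time_average P L) f x = (\sum_(k < L) iter k (act P) f x) / L%:R.
Proof.
rewrite /act /time_average; under eq_bigr do rewrite mulrAC mulr_suml.
rewrite -mulr_suml exchange_big; congr (_ / _).
by apply: eq_bigr => k _; rewrite -iter_actE.
Qed.

Lemma cesaro_stochastic P L :
  (0 < L)%N -> stochastic P -> stochastic (time_average P L).
Proof.
move=> L0 Ps x; split=> [y|].
  rewrite divr_ge0// sumr_ge0// => k _.
  by case: (step_prob_stochastic k Ps x).
rewrite -mulr_suml exchange_big /=.
under eq_bigr do rewrite (step_prob_stochastic _ Ps _).2.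
by rewrite sumr_const card_ord divff// pnatr_eq0 -lt0n.
Qed.

(* Shifting a Cesaro average of length [L] by one step replaces one of its [L]
   terms. *)
Lemma act_cesaro_shift P L f x : (0 < L)%N ->
  act P (act (time_average P L) f) x =
  act (time_average P L) f x + (iter L (act P) f x - f x) / L%:R.
Proof.
move=> L0; rewrite {1}/act.
under eq_bigr do rewrite act_cesaroE mulrA mulr_sumr.
rewrite -mulr_suml act_cesaroE -mulrDl; congr (_ / _).
rewrite exchange_big /=.
transitivity (\sum_(k < L) iter k.+1 (act P) f x); first by [].
(* Both sides are the same sum of [L + 1] terms; the left loses its first term and the right its
   last. *)
have : \sum_(k < L.+1) iter k (act P) f x = \sum_(k < L.+1) iter k (act P) f x by [].
rewrite {1}big_ord_recl big_ord_recr /= => E.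
have -> : \sum_(k < L) iter k.+1 (act P) f x
  = \sum_(i < L) iter (bump 0 i) (act P) f x by apply: eq_bigr.
by rewrite addrA -E addrC addKr.
Qed.

End MarkovOperator.

(** * Autocovariances of a lazy reversible chain *)

Section Reversible.
Context {R : realType} {S : finType}.

Definition inner (pi f g : S -> R) : R := \sum_x pi x * (f x * g x).

(** For stationary [pi] this is the mean of [g (X_0) * g (X_n)] under the stationary chain, an
    autocovariance when [g] has mean zero. *)
Definition autocov (P : S -> S -> R) (pi g : S -> R) (n : nat) : R :=
  inner pi g (iter n (act P) g).

Variables (P Q : S -> S -> R) (pi : S -> R).
Hypotheses (Qst : stochastic Q) (PE : forall x y, P x y = lazy_version Q x y).
Hypotheses (pist : distribution_on pi) (db : detailed_balance P pi).

Local Notation ip := (inner pi).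
Local Notation psi := (autocov P pi).

Let pi_ge0 x : 0 <= pi x. Proof. by case: pist. Qed.
Let Q_ge0 x y : 0 <= Q x y. Proof. by case: (Qst x). Qed.

(** Off the diagonal [P] is [Q / 2], so reversibility passes to [Q]. *)
Let dbQ x y : pi x * Q x y = pi y * Q y x.
Proof.
have := db x y; rewrite !PE /lazy_version.
case: (eqVneq x y) => [->//|xy]; rewrite !addr0 !mulrA.
by move=> /(mulIf _); apply; rewrite invr_eq0.
Qed.

Let actP f x : act P f x = (act Q f x + f x) / 2.
Proof.
rewrite /act; under eq_bigr do rewrite PE mulrAC mulrDl.
rewrite -mulr_suml big_split /=; congr ((_ + _) / _).
rewrite (bigD1 x)//= eqxx mul1r big1 ?addr0// => y yx.
by rewrite eq_sym (negbTE yx) mul0r.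
Qed.

Let ip_sym f g : ip f (act Q g) = ip (act Q f) g.
Proof.
rewrite /inner /act; under eq_bigr do rewrite mulr_sumr mulr_sumr.
rewrite exchange_big; apply: eq_bigr => y _ /=.
rewrite mulr_suml mulr_sumr; apply: eq_bigr => x _.
have := dbQ x y; set a := pi x; set b := pi y => E.
transitivity ((a * Q x y) * (f x * g y)); first by ring.
by rewrite E; ring.
Qed.

Let ip_symP f g : ip f (act P g) = ip (act P f) g.
Proof.
have -> : ip f (act P g) = (ip f (act Q g) + ip f g) / 2.
  by rewrite /inner -big_split /= mulr_suml; apply: eq_bigr => x _; rewrite actP; field.
rewrite ip_sym /inner -big_split /= mulr_suml; apply: eq_bigr => x _.
by rewrite actP; field.
Qed.

Let sumQ x a : \sum_y pi x * Q x y * a = pi x * a.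
Proof. by rewrite -mulr_suml -mulr_sumr (Qst x).2 mulr1. Qed.

Let sumQr (f : S -> R) : \sum_x \sum_y pi x * Q x y * f y = \sum_y pi y * f y.
Proof.
rewrite exchange_big; apply: eq_bigr => y _ /=; rewrite -sumQ.
by apply: eq_bigr => x _; rewrite dbQ.
Qed.

(** At [s = -1] this is twice the Dirichlet form of [Q]; using both signs bounds the quadratic form
    of [Q] by that of the identity, without a spectral decomposition. *)
Let dirichlet (s : R) f :
  \sum_x \sum_y pi x * Q x y * (f x + s * f y) ^+ 2 =
  (1 + s ^+ 2) * ip f f + 2 * s * ip f (act Q f).
Proof.
transitivity (\sum_x \sum_y (pi x * Q x y * (f x) ^+ 2) +
   s ^+ 2 * (\sum_x \sum_y (pi x * Q x y * (f y) ^+ 2)) +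
   2 * s * ip f (act Q f)).
  rewrite !mulr_sumr -!big_split; apply: eq_bigr => x _ /=.
  rewrite /act !mulr_sumr -!big_split; apply: eq_bigr => y _ /=; ring.
rewrite sumQr; under eq_bigr do rewrite sumQ.
have -> : \sum_x pi x * f x ^+ 2 = ip f f by [].
rewrite [in RHS]mulrDl [in RHS]mul1r. reflexivity.
Qed.

Let ip_ge0 f : 0 <= ip f f.
Proof. by rewrite sumr_ge0// => x _; rewrite mulr_ge0// -expr2 sqr_ge0. Qed.

Let ipQ_bound (s : R) f : s ^+ 2 = 1 -> 0 <= ip f f + s * ip f (act Q f).
Proof.
move=> s1; have : 0 <= \sum_x \sum_y pi x * Q x y * (f x + s * f y) ^+ 2.
  by apply: sumr_ge0 => x _; apply: sumr_ge0 => y _; rewrite mulr_ge0 ?sqr_ge0// mulr_ge0.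
by rewrite dirichlet s1; lra.
Qed.

Let ipQQ f : ip (act Q f) (act Q f) <= ip f f.
Proof.
(* Jensen: the variance of [f] under each row of [Q] is nonnegative *)
have : 0 <= \sum_x \sum_y pi x * Q x y * (act Q f x - f y) ^+ 2.
  by apply: sumr_ge0 => x _; apply: sumr_ge0 => y _; rewrite mulr_ge0 ?sqr_ge0// mulr_ge0.
suff -> : \sum_x \sum_y pi x * Q x y * (act Q f x - f y) ^+ 2
   = ip f f - ip (act Q f) (act Q f) by rewrite subr_ge0.
transitivity (\sum_x \sum_y (pi x * Q x y * (f y) ^+ 2)
  - ip (act Q f) (act Q f)); last by rewrite sumQr.
rewrite /inner -sumrB; apply: eq_bigr => x _.
set a := act Q f x.
have -> : pi x * (a * a) = \sum_y (2 * a * (pi x * (Q x y * f y)) - pi x * Q x y * (a * a)).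
  rewrite sumrB sumQ -!mulr_sumr -/(act Q f x) -/a; ring.
rewrite -sumrB; apply: eq_bigr => y _; ring.
Qed.

Let ip_iter m n f g :
  ip (iter m (act P) f) (iter n (act P) g) = ip f (iter (m + n) (act P) g).
Proof.
elim: m n => // m IH n; rewrite [iter m.+1 _ _]/= -ip_symP -iterS IH.
by rewrite addnS.
Qed.

Let autocov_even g k : psi g (k + k) = ip (iter k (act P) g) (iter k (act P) g).
Proof. by rewrite ip_iter. Qed.

Let autocov_odd g k :
  psi g (k + k).+1 = ip (iter k (act P) g) (act P (iter k (act P) g)).
Proof. by rewrite -iterS ip_iter addnS. Qed.

Let ipP f g : ip f (act P g) = (ip f (act Q g) + ip f g) / 2.
Proof.
rewrite /inner -big_split /= mulr_suml.
by apply: eq_bigr => x _; rewrite actP; field.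
Qed.

(** Even lags are squared norms. Odd lags are [<h, P h>] with [P = (I + Q) / 2], nonnegative because
    [Q >= -I] as a form: this is where laziness enters. *)
Lemma autocov_ge0 g n : 0 <= psi g n.
Proof.
have [k [->|->]] : exists k, n = (k + k)%N \/ n = (k + k).+1.
  by exists n./2; rewrite addnn -{1 3}(odd_double_half n); case: (odd n); [right|left].
- by rewrite autocov_even.
- rewrite autocov_odd ipP; set h := iter k _ g.
  have := @ipQ_bound 1 h (expr1n _ _); lra.
Qed.

(** From an even lag the drop is [<h, (I - Q) h> / 2]; from an odd one it is [<h, P (I - P) h> =
    (<h, h> - <Q h, Q h>) / 4], nonnegative since [Q] contracts. *)
Lemma autocov_nincr g n : psi g n.+1 <= psi g n.
Proof.
have [k [->|->]] : exists k, n = (k + k)%N \/ n = (k + k).+1.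
  by exists n./2; rewrite addnn -{1 3}(odd_double_half n); case: (odd n); [right|left].
- rewrite autocov_even autocov_odd ipP; set h := iter k _ g.
  have := @ipQ_bound (- 1) h; rewrite sqrrN expr1n => /(_ erefl); lra.
- have -> : (k + k).+2 = (k.+1 + k.+1)%N by rewrite addSn addnS.
  rewrite autocov_even autocov_odd /= -!ip_symP !ipP.
  set h := iter k _ g.
  have -> : ip h (act Q (act P h)) = (ip (act Q h) (act Q h) + ip h (act Q h)) / 2.
    rewrite ip_sym ipP; congr (_ / _); congr (_ + _).
    by rewrite ip_sym.
  have := ipQQ h; lra.
Qed.

Lemma autocov_nincr_le g m n : (m <= n)%N -> psi g n <= psi g m.
Proof.
move=> /subnKC <-; elim: (n - m)%N => [|k IH]; rewrite ?addn0// addnS.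
by apply: le_trans IH; exact: autocov_nincr.
Qed.

(** Second differences of autocovariances are again autocovariances, so [autocov_ge0] yields
    convexity. *)
Lemma autocov_diff g n : psi (fun x => g x - act P g x) n
  = (psi g n - psi g n.+1) - (psi g n.+1 - psi g n.+2).
Proof.
have ipBr a b c : ip a (fun x => b x - c x) = ip a b - ip a c.
  by rewrite /inner -sumrB; apply: eq_bigr => x _; ring.
have ipBl a b c : ip (fun x => b x - c x) a = ip b a - ip c a.
  by rewrite /inner -sumrB; apply: eq_bigr => x _; ring.
rewrite /autocov iter_actB -!iterSr ipBr !ipBl -!ip_symP -!iterS; ring.
Qed.

Lemma autocov_drop_nincr g m n : (m <= n)%N ->
  psi g n - psi g n.+1 <= psi g m - psi g m.+1.
Proof.
move=> /subnKC <-; elim: (n - m)%N => [|k IH]; rewrite ?addn0// addnS.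
apply: le_trans IH; rewrite -subr_ge0 -autocov_diff; exact: autocov_ge0.
Qed.

(* The increments of [r |-> P^r g] are controlled by second differences of the
   convex sequence [psi g], whose sum telescopes. *)
Lemma sum_increments g L :
  L%:R * \sum_(r < L) ip (fun x => iter (L + r) (act P) g x - iter (L + r).+1 (act P) g x)
                  (fun x => iter (L + r) (act P) g x - iter (L + r).+1 (act P) g x)
  <= psi g L - psi g (L + L).
Proof.
pose D n := psi g n - psi g n.+1.
have incr k : ip (fun x => iter k (act P) g x - iter k.+1 (act P) g x)
                 (fun x => iter k (act P) g x - iter k.+1 (act P) g x)
   <= D (k + k)%N - D (k.+1 + k.+1)%N.
  have -> : (fun x => iter k (act P) g x - iter k.+1 (act P) g x)
     = iter k (act P) (fun x => g x - act P g x) by rewrite iter_actB -iterSr.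
  rewrite -autocov_even autocov_diff lerD2l lerN2 addSn addnS.
  exact: autocov_drop_nincr.
have telesc n :
    \sum_(r < n) ip (fun x => iter (L + r) (act P) g x - iter (L + r).+1 (act P) g x)
                  (fun x => iter (L + r) (act P) g x - iter (L + r).+1 (act P) g x)
    <= D (L + L)%N - D (L + n + (L + n))%N.
  elim: n => [|n IH]; first by rewrite big_ord0 addn0 subrr.
  rewrite big_ord_recr /=; apply: le_trans (lerD IH (incr _)) _.
  by rewrite -!addnS; lra.
apply: (@le_trans _ _ (L%:R * D (L + L)%N)).
  rewrite ler_wpM2l// (le_trans (telesc L))// gerBl subr_ge0.
  exact: autocov_nincr.
(* As [D] is nonincreasing, [D (L + n)] is at most each of the [n] drops before it, which telescope.
   The case [n = L] is the one used. *)
have : forall n, n%:R * D (L + n)%N <= psi g L - psi g (L + n).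
  elim=> [|n IH]; first by rewrite mul0r addn0 subrr.
  have h1 : D (L + n.+1)%N <= D (L + n)%N by apply: autocov_drop_nincr; rewrite leq_add2l.
  have h2 : n%:R * D (L + n.+1)%N <= n%:R * D (L + n)%N by rewrite ler_wpM2l.
  rewrite -natr1 mulrDl mul1r; move: h1 h2 IH; rewrite /D addnS; lra.
exact.
Qed.

(** * From time averages close to stationarity to mixing at time [2L] *)

Variables (L : nat) (delta : R).
Hypotheses (L_gt0 : (0 < L)%N)
  (cesaro_close : forall x (A : {set S}),
     \sum_(y in A) pi y - \sum_(y in A) time_average P L x y <= delta).

Let Pst : stochastic P.
Proof. by apply: is_lazy_stochastic; exists Q. Qed.

(** The differences sum to zero, so their positive and negative parts have equal mass; the one-sided
    hypothesis, taken at the set where [pi] dominates, bounds both. *)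
Let cesaro_l1 x : \sum_y `|time_average P L x y - pi y| <= 2 * delta.
Proof.
pose A := [set y | time_average P L x y <= pi y].
have C1 : \sum_y (time_average P L x y - pi y) = 0.
  by rewrite sumrB (cesaro_stochastic L_gt0 Pst x).2 pist.2 subrr.
have E : \sum_(y in A) `|time_average P L x y - pi y|
    = \sum_(y in A) (pi y - time_average P L x y).
  by apply: eq_bigr => y; rewrite inE => yA; rewrite ler0_norm ?subr_le0// opprB.
have E' : \sum_(y in ~: A) `|time_average P L x y - pi y|
    = \sum_(y in A) (pi y - time_average P L x y).
  transitivity (\sum_(y in ~: A) (time_average P L x y - pi y)).
    apply: eq_bigr => y; rewrite !inE -ltNge => yA.
    by rewrite ger0_norm// subr_ge0 ltW.
  apply/eqP; rewrite -subr_eq0; apply/eqP; rewrite -[RHS]C1 [RHS](bigID (mem A)) /= [RHS]addrC.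
  congr (_ + _); first by apply: eq_bigl => y; rewrite inE.
  by rewrite -sumrN; apply: eq_bigr => y _; rewrite opprB.
rewrite (bigID (mem A)) /= E.
rewrite (eq_bigl (mem (~: A))) => [|y]; last by rewrite !inE.
have := cesaro_close x A; rewrite E' -sumrB; lra.
Qed.

Variable g : S -> R.
Hypotheses (g_le1 : forall x, `|g x| <= 1) (g_mean0 : \sum_x pi x * g x = 0).

(** By monotonicity [psi g L] is at most the mean of [psi g k] over [k < L]. This mean is the inner
    product of [g] with its time average, which is uniformly small since [g] has mean zero. *)
Lemma autocov_cesaro : psi g L <= 2 * delta.
Proof.
have H1 : L%:R * psi g L <= \sum_(k < L) psi g k.
  rewrite mulr_natl -[X in _ *+ X]card_ord -sumr_const.
  by apply: ler_sum => k _; apply: autocov_nincr_le; apply: ltnW.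
have H2 : \sum_(k < L) psi g k = L%:R * ip g (act (time_average P L) g).
  rewrite /autocov /inner exchange_big mulr_sumr; apply: eq_bigr => x _ /=.
  rewrite -mulr_sumr -mulr_sumr act_cesaroE.
  by field; rewrite pnatr_eq0 -lt0n.
have H3 : ip g (act (time_average P L) g) <= 2 * delta.
  have <- : \sum_x pi x * (2 * delta) = 2 * delta by rewrite -mulr_suml pist.2 mul1r.
  apply: ler_sum => x _; apply: ler_wpM2l => //.
  have -> : act (time_average P L) g x = \sum_y (time_average P L x y - pi y) * g y.
    under [RHS]eq_bigr do rewrite mulrBl.
    by rewrite sumrB g_mean0 subr0.
  apply: le_trans (ler_norm _) _; apply: le_trans (cesaro_l1 x).
  rewrite normrM -[leRHS]mul1r ler_pM// (le_trans (ler_norm_sum _ _ _))//.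
  by apply: ler_sum => y _; rewrite normrM ler_piMr.
rewrite -(ler_pM2l (x := L%:R)) ?ltr0n//.
by apply: le_trans H1 _; rewrite H2 ler_wpM2l.
Qed.

Let incr r y := iter (L + r) (act P) g y - iter (L + r).+1 (act P) g y.

(** Controls the whole stretch [P^s g], [L <= s <= 2L], pointwise: the square at time [L] plus the
    squared increments, weighted by [L] as in Cauchy-Schwarz. *)
Let w y := iter L (act P) g y * iter L (act P) g y
  + L%:R * \sum_(r < L) incr r y * incr r y.

Let mean_w : \sum_y pi y * w y <= psi g L.
Proof.
have -> : \sum_y pi y * w y = psi g (L + L) + L%:R * \sum_(r < L) ip (incr r) (incr r).
  rewrite /inner exchange_big mulr_sumr autocov_even -big_split; apply: eq_bigr => y _ /=.
  by rewrite /w mulrDr -mulr_sumr; ring.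
have := sum_increments g L; rewrite /incr; lra.
Qed.

(** Scaled so that [n] increments together cost the constant [1 / 32], whatever [n] is; the value at
    time [L] costs another [1 / 32], whence the [1 / 16] in [u]. *)
Let amgm (n : nat) (a : R) : (0 < n)%N -> `|a| <= 1 / (32 * n%:R) + 8 * n%:R * (a * a).
Proof.
move=> n0; have n0' : 0 < n%:R :> R by rewrite ltr0n.
have -> : a * a = `|a| ^+ 2 by rewrite -normrX expr2 ger0_norm// -expr2 sqr_ge0.
rewrite -subr_ge0.
have -> : 1 / (32 * n%:R) + 8 * n%:R * `|a| ^+ 2 - `|a|
   = (1 - 16 * n%:R * `|a|) ^+ 2 / (32 * n%:R) by field; rewrite gt_eqF.
by rewrite divr_ge0 ?sqr_ge0// mulr_ge0// ltW.
Qed.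

Let iter_le1 n y : `|iter n (act P) g y| <= 1.
Proof.
rewrite iter_actE; have [p0 p1] := step_prob_stochastic n Pst y.
rewrite -[leRHS]p1 (le_trans (ler_norm_sum _ _ _))//; apply: ler_sum => z _.
by rewrite normrM ger0_norm// ler_piMr.
Qed.

(** Truncation at [1], harmless because the iterates of [g] stay in [[-1, 1]], makes [u] a bounded
    test function to which [cesaro_l1] applies. *)
Let u y := Num.min 1 (1 / 16 + 8 * w y).

Let late_le_u j y : (j <= L)%N -> `|iter (L + j) (act P) g y| <= u y.
Proof.
move=> jL; rewrite /u le_min iter_le1 /=.
have tel n : `|iter (L + n) (act P) g y| <= `|iter L (act P) g y| + \sum_(r < n) `|incr r y|.
  elim: n => [|n IH]; first by rewrite big_ord0 addr0 addn0.
  rewrite big_ord_recr addnS; move: IH.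
  have : `|iter (L + n).+1 (act P) g y| <= `|iter (L + n) (act P) g y| + `|incr n y|.
    have -> : iter (L + n).+1 (act P) g y = iter (L + n) (act P) g y - incr n y.
      by rewrite /incr; ring.
    exact: ler_normB.
  rewrite /=; lra.
apply: (le_trans (tel j)).
have H : \sum_(r < j) `|incr r y| <= \sum_(r < L) `|incr r y|.
  rewrite -!(big_mkord xpredT (fun r => `|incr r y|)) (big_cat_nat _ jL)//=.
  by rewrite lerDl sumr_ge0.
have H' : \sum_(r < L) `|incr r y| <= 1 / 32 + 8 * L%:R * \sum_(r < L) incr r y * incr r y.
  have <- : \sum_(r < L) (1 / (32 * L%:R) + 8 * L%:R * (incr r y * incr r y)) =
     1 / 32 + 8 * L%:R * \sum_(r < L) incr r y * incr r y.
    rewrite big_split /= sumr_const card_ord -mulr_natr mulr_sumr; congr (_ + _).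
    by field; rewrite pnatr_eq0 -lt0n.
  by apply: ler_sum => r _; exact: amgm.
have := @amgm 1 (iter L (act P) g y) isT.
rewrite /w; lra.
Qed.

Lemma lazy_mixing x : `|iter (L + L) (act P) g x| <= 1 / 16 + 18 * delta.
Proof.
have w_ge0 y : 0 <= w y.
  rewrite /w addr_ge0 -?expr2 ?sqr_ge0// mulr_ge0// sumr_ge0// => r _.
  by rewrite -expr2 sqr_ge0.
have u_ge0 y : 0 <= u y by rewrite /u le_min ler01 /= addr_ge0// mulr_ge0.
have u_le1 y : u y <= 1 by rewrite /u ge_min lexx.
(* For each [k < L] write [2L = k + (L + (L - k))]: after [k] steps the remaining iterate is bounded
   by [u]. Then average over [k]. *)
have norm_cesaro : `|iter (L + L) (act P) g x| <= act (time_average P L) u x.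
  rewrite act_cesaroE ler_pdivlMr ?ltr0n// mulr_natr -[X in _ *+ X]card_ord -sumr_const.
  apply: ler_sum => k _.
  have -> : (L + L = k + (L + (L - k)))%N by rewrite addnCA subnKC// ltnW.
  rewrite iterD !iter_actE (le_trans (ler_norm_sum _ _ _))//.
  apply: ler_sum => y _; have p0 := (step_prob_stochastic k Pst x).1 y.
  by rewrite normrM ger0_norm// ler_wpM2l// late_le_u// leq_subr.
have mean_u : \sum_y pi y * u y <= 1 / 16 + 8 * (2 * delta).
  apply: (@le_trans _ _ (\sum_y (pi y * (1 / 16) + 8 * (pi y * w y)))).
    apply: ler_sum => y _; rewrite [8 * _]mulrCA -mulrDr ler_wpM2l//.
    by rewrite /u ge_min lexx orbT.
  rewrite big_split /= -mulr_suml pist.2 mul1r -mulr_sumr lerD2l ler_wpM2l//.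
  exact: le_trans mean_w autocov_cesaro.
(* Replacing the time average by [pi] costs [2 * delta]; with the [16 * delta] in [mean_u] this
   makes [18 * delta]. *)
have : act (time_average P L) u x <= \sum_y pi y * u y + 2 * delta.
  rewrite -lerBlDl /act -sumrB; apply: le_trans (cesaro_l1 x).
  apply: ler_sum => y _; rewrite -mulrBl; apply: le_trans (ler_norm _) _.
  by rewrite normrM [`|u y|]ger0_norm// ler_piMr.
move: norm_cesaro mean_u; lra.
Qed.

End Reversible.

(** * Killed chains and path laws *)

Section KilledChain.
Context {R : realType} {S : finType}.
Implicit Types (P : S -> S -> R) (D : pred S).

Definition killed P D : S -> S -> R := fun a b => P a b * (D b)%:R.

(** [killed] tests only the state entered, so time [0] needs the separate factor [(D x)%:R]. *)
Definition stay_prob P D n x : R :=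
  (D x)%:R * \sum_z step_prob (killed P D) n x z.

Lemma killed_ge0 P D : (forall x y, 0 <= P x y) -> forall x y, 0 <= killed P D x y.
Proof. by move=> P0 x y; rewrite mulr_ge0// ler0n. Qed.

(* The maximal inequality for the nonnegative supermartingale
   [f (X_k) + (t - k) * c]. *)
Lemma stay_prob_lower P D (f : S -> R) (c lam eta : R) t x :
  stochastic P -> 0 <= c -> (forall y, 0 <= f y) ->
  (forall y, act P f y <= f y + c) -> (forall y, ~~ D y -> lam <= f y) ->
  0 < eta -> 0 < lam -> f x + t%:R * c <= lam - eta ->
  eta / lam <= stay_prob P D t x.
Proof.
move=> Ps c0 f0 Pf Df eta0 lam0 fx.
have tc : 0 <= t%:R * c by rewrite mulr_ge0.
have Dx : D x by apply: contraLR isT => /Df; lra.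
rewrite /stay_prob Dx mul1r.
pose m n z := step_prob (killed P D) n x z.
have mS n z : m n.+1 z = \sum_w m n w * (P w z * (D z)%:R) by [].
have m0 n z : 0 <= m n z.
  by apply: step_prob_ge0 => a b; apply: killed_ge0 => // a' b'; case: (Ps a').
(* Mass that has left [D] is charged [lam], at most the value of [f] where it left, so the stopped
   potential grows by at most [c] times the surviving mass. *)
have step n : \sum_z m n.+1 z * f z + lam * (1 - \sum_z m n.+1 z)
    <= \sum_z m n z * f z + lam * (1 - \sum_z m n z) + c * \sum_z m n z.
  have H1 : \sum_w m n w * act P f w <= \sum_z m n z * f z + c * \sum_z m n z.
    rewrite mulr_sumr -big_split /=; apply: ler_sum => z _.
    by rewrite [c * _]mulrC -mulrDr ler_wpM2l.
  have H2 : \sum_w m n w * act P f w =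
     \sum_z m n.+1 z * f z + \sum_w \sum_z m n w * P w z * (~~ D z)%:R * f z.
    under eq_bigr do rewrite mulr_sumr.
    under [X in _ = X + _]eq_bigr do rewrite mS mulr_suml.
    rewrite [X in _ = X + _]exchange_big -big_split; apply: eq_bigr => w _ /=.
    rewrite -big_split; apply: eq_bigr => z _ /=.
    by case: (D z) => /=; ring.
  have H3 : \sum_z m n z = \sum_z m n.+1 z + \sum_w \sum_z m n w * P w z * (~~ D z)%:R.
    under [X in _ = X + _]eq_bigr do rewrite mS.
    rewrite [X in _ = X + _]exchange_big -big_split; apply: eq_bigr => w _ /=.
    rewrite -big_split -[LHS]mulr1 -[X in _ * X](Ps w).2 mulr_sumr.
    apply: eq_bigr => z _ /=.
    by case: (D z) => /=; ring.
  have H4 : lam * \sum_w \sum_z m n w * P w z * (~~ D z)%:R <=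
     \sum_w \sum_z m n w * P w z * (~~ D z)%:R * f z.
    rewrite mulr_sumr; apply: ler_sum => w _; rewrite mulr_sumr.
    apply: ler_sum => z _; rewrite mulrC.
    have [P0 _] := Ps w.
    case: (boolP (D z)) => Dz; first by rewrite mulr0 !mul0r.
    by rewrite ler_wpM2l ?Df// mulr1 mulr_ge0.
  move: H1 H4; rewrite H2 H3; lra.
have m_le1 n : \sum_z m n z <= 1.
  elim: n => [|n IH].
    by rewrite (bigD1 x)//= /m /= eqxx big1 ?addr0// => z zx; rewrite eq_sym (negbTE zx).
  apply: le_trans IH; rewrite exchange_big; apply: ler_sum => w _ /=.
  rewrite -mulr_sumr -[leRHS]mulr1; apply: ler_wpM2l; first exact: m0.
  rewrite -[leRHS](Ps w).2; apply: ler_sum => z _.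
  by rewrite ler_piMr ?lern1 ?leq_b1//; case: (Ps w).
have all n : \sum_z m n z * f z + lam * (1 - \sum_z m n z) <= f x + n%:R * c.
  elim: n => [|n IH].
    have d g : \sum_z m 0%N z * g z = g x.
      rewrite (bigD1 x)//= /m /= eqxx mul1r big1 ?addr0// => z zx.
      by rewrite eq_sym (negbTE zx) mul0r.
    rewrite d; have := d (fun=> 1); under eq_bigr do rewrite mulr1.
    by move=> ->; lra.
  apply: le_trans (step n) _; rewrite -natr1.
  have : c * \sum_z m n z <= c * 1 by rewrite ler_wpM2l.
  move: IH; lra.
rewrite ler_pdivrMr//.
have : 0 <= \sum_z m t z * f z by rewrite sumr_ge0// => z _; rewrite mulr_ge0.
have := all t; rewrite /m; lra.
Qed.

End KilledChain.

(** * Probability that a chain stays in a set *)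

Section ChainLaw.
Context {R : realType} {S : finType} {d : measure_display}
        {Omega : measurableType d}.
Implicit Types (Pr : probability Omega R) (X Y : nat -> Omega -> S).
Local Open Scope classical_set_scope.

Lemma measure_finite_partition Pr (U : finType) (f : Omega -> U) (A : set Omega) :
  (forall u, measurable (f @^-1` [set u])) -> measurable A ->
  Pr A = (\sum_(u : U) Pr (A `&` f @^-1` [set u]))%E.
Proof.
move=> mf mA.
have {1}-> : A = \bigcup_(u in [set` index_enum U]) (A `&` f @^-1` [set u]).
  apply/seteqP; split=> [w Aw|w [u _ []//]].
  by exists (f w) => //=; rewrite mem_index_enum.
rewrite measure_fin_bigcup //; first last.
- by move=> u _; apply: measurableI.
- by move=> u v _ _ [w [[_ <-] [_ <-]]].
by rewrite -(@fsbig_seq _ _ _ _ (index_enum U) _ (index_enum_uniq U)).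
Qed.

Variables (Pr : probability Omega R) (X : nat -> Omega -> S)
  (P : S -> S -> R) (x0 : S).
Hypothesis chainX : is_chain Pr X P x0.

Let mX n (B : set S) : measurable (X n @^-1` B). Proof. by case: chainX. Qed.

Lemma measurable_stay (D : pred S) n :
  measurable [set w | forall i, (i <= n)%N -> D (X i w)].
Proof.
have -> : [set w | forall i, (i <= n)%N -> D (X i w)] =
    \bigcap_(i in [set i | (i <= n)%N]) (X i @^-1` [set y | D y]) by [].
by apply: bigcap_measurableType => i _.
Qed.

(** [is_chain] gives the Markov property only on fully specified pasts. The event is cut along the
    finitely many trajectories up to time [n], each contained in it or disjoint from it. *)
Lemma stay_step (D : pred S) n a b :
  Pr ([set w | forall i, (i <= n)%N -> D (X i w)] `&` X n @^-1` [set a]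
      `&` X n.+1 @^-1` [set b]) =
  (Pr ([set w | forall i, (i <= n)%N -> D (X i w)] `&` X n @^-1` [set a])
   * (P a b)%:E)%E.
Proof.
set E := _ `&` X n @^-1` [set a].
have mE : measurable E by apply: measurableI; [exact: measurable_stay|].
pose f w : {ffun 'I_n.+1 -> S} := [ffun i : 'I_n.+1 => X i w].
have mf u : measurable (f @^-1` [set u]).
  have -> : f @^-1` [set u] = \bigcap_(i in [set: 'I_n.+1]) (X i @^-1` [set u i]).
    apply/seteqP; split=> [w <- i _ /=|w fw]; first by rewrite ffunE.
    by apply/ffunP => i; rewrite ffunE; exact: fw.
  exact: fin_bigcap_measurable.
rewrite (measure_finite_partition Pr mf (measurableI _ _ mE (mX n.+1 [set b]))).
rewrite (measure_finite_partition Pr mf mE).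
rewrite ge0_sume_distrl; last by move=> u _; exact: measure_ge0.
apply: eq_bigr => u _.
pose v i := u (inord i).
have fE : f @^-1` [set u] = [set w | forall i, (i <= n)%N -> X i w = v i].
  apply/seteqP; split=> [w fw i ni /=|w fw].
    by rewrite /v -fw ffunE inordK.
  apply/ffunP => i; rewrite ffunE; have := fw i; rewrite /v inord_val; apply.
  by rewrite -ltnS.
have [[w [[Ew Ew'] fw]]|noE] := pselect (E `&` f @^-1` [set u] !=set0).
  have sub : f @^-1` [set u] `<=` E.
    rewrite fE => w' fw'; move: fw; rewrite fE => fw.
    split=> [i ni|/=]; first by rewrite /= fw'// -fw//; exact: Ew.
    by rewrite fw'// -fw.
  have vn : v n = a by move: fw; rewrite fE => /(_ n (leqnn n)) <-.
  rewrite setIAC (setIidr sub) fE -vn.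
  by case: chainX => _ _; apply.
have E0 : E `&` f @^-1` [set u] = set0.
  by apply/seteqP; split=> // w Ew; apply: noE; exists w.
by rewrite setIAC E0 set0I measure0 mul0e.
Qed.

Lemma stay_at_law (D : pred S) n z :
  Pr ([set w | forall i, (i <= n)%N -> D (X i w)] `&` X n @^-1` [set z]) =
  ((D x0)%:R * step_prob (killed P D) n x0 z)%:E.
Proof.
elim: n z => [|n IH] z.
  have X0 : Pr (X 0%N @^-1` [set z]) = ((x0 == z)%:R)%:E.
    have [_ Px0 _] := chainX.
    case: eqVneq => [<-//|xz].
    have Z : Pr (~` (X 0%N @^-1` [set x0])) = 0%E.
      by rewrite probability_setC// Px0 subee.
    apply/eqP; rewrite -measure_le0 -Z.
    apply: le_measure; rewrite ?inE//; first exact: measurableC.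
    by move=> w /= -> /eqP; rewrite eq_sym (negbTE xz).
  case: (boolP (D z)) => Dz.
    rewrite (_ : _ `&` _ = X 0%N @^-1` [set z]) ?X0.
      congr EFin => /=; case: eqVneq => [->|]; last by rewrite mulr0.
      by rewrite Dz mulr1.
    apply/seteqP; split=> [w []//|w Xw]; split=> // i; rewrite leqn0 => /eqP ->.
    by rewrite Xw.
  rewrite (_ : _ `&` _ = set0).
    rewrite measure0 /=; case: eqVneq => [->|]; last by rewrite mulr0.
    by rewrite (negbTE Dz) mul0r.
  apply/seteqP; split=> // w [/(_ 0%N isT) Dw Xw].
  by move: Dw; rewrite Xw (negbTE Dz).
set F := [set w | forall i, (i <= n)%N -> D (X i w)].
case: (boolP (D z)) => Dz; last first.
  rewrite (_ : _ `&` _ = set0); last first.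
    apply/seteqP; split=> // w [/(_ n.+1 (leqnn _)) Dw Xw].
    by move: Dw; rewrite Xw (negbTE Dz).
  rewrite measure0 /= big1 ?mulr0// => w _.
  by rewrite /killed (negbTE Dz) !mulr0.
rewrite (_ : _ `&` _ = F `&` X n.+1 @^-1` [set z]); last first.
  apply/seteqP; split=> [w [Dw Xw]|w [Dw Xw]]; split=> // i.
    by move=> ni; apply: Dw; exact: leqW.
  by rewrite leq_eqVlt => /orP[/eqP ->|]; [rewrite Xw|rewrite ltnS; exact: Dw].
rewrite (measure_finite_partition (f := X n) Pr) //; last first.
  by apply: measurableI => //; exact: measurable_stay.
under eq_bigr => a _ do rewrite setIAC stay_step IH -EFinM.
rewrite sumEFin /= mulr_sumr; congr EFin; apply: eq_bigr => a _.
by rewrite /killed Dz mulr1 mulrA.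
Qed.

Lemma stay_law (D : pred S) n :
  Pr [set w | forall i, (i <= n)%N -> D (X i w)] = (stay_prob P D n x0)%:E.
Proof.
rewrite (measure_finite_partition (f := X n) Pr)//; last exact: measurable_stay.
by under eq_bigr do rewrite stay_at_law; rewrite sumEFin /stay_prob mulr_sumr.
Qed.

(** Needed because independence is stated on generated sigma-algebras; the event is the complement
    of a countable union, padded with [set0] beyond [n]. *)
Lemma sigma_process_stay (D : pred S) n :
  sigma_process X [set w | forall i, (i <= n)%N -> D (X i w)].
Proof.
rewrite -[X in sigma_process _ X]setCK; apply: sigma_algebraC.
rewrite (_ : ~` _ = \bigcup_i (if (i <= n)%N then ~` (X i @^-1` [set y | D y]) else set0)).
  apply: sigma_algebra_bigcup => i; case: ifP => _; last exact: sigma_algebra0.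
  by apply: sigma_algebraC; apply: sub_sigma_algebra; exists i, [set y | D y].
apply/seteqP; split=> [w /existsNP[i] /not_implyP[ni Dw]|w [i _]].
  by exists i; rewrite ?ni.
by case: ifP => // ni Dw /(_ i ni).
Qed.

End ChainLaw.

(** * The intersection time and disjointness of paths *)

Section Intersections.
Context {R : realType} {S : finType} {d : measure_display}
        {Omega : measurableType d}.
Variables (Pr : probability Omega R) (X Y : nat -> Omega -> S)
  (P : S -> S -> R) (x y : S).
Hypotheses (chainX : is_chain Pr X P x) (chainY : is_chain Pr Y P y)
  (indep : independent_processes Pr X Y).
Local Open Scope classical_set_scope.

Definition disjoint_paths n : set Omega :=
  [set w | forall i j, (i <= n)%N -> (j <= n)%N -> X i w <> Y j w].

Lemma measurable_disjoint_paths n : measurable (disjoint_paths n).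
Proof.
have -> : disjoint_paths n = \bigcap_(i in [set i | (i <= n)%N])
    \bigcap_(j in [set j | (j <= n)%N]) \bigcap_(s in [set: S])
    ~` (X i @^-1` [set s] `&` Y j @^-1` [set s]).
  apply/seteqP; split=> [w dw i /= ni j /= nj s _ [Xs Ys]|w dw i j ni nj XY].
    by apply: (dw i j) => //; rewrite Xs Ys.
  exact: (dw i ni j nj (X i w) I).
have [mX _ _] := chainX; have [mY _ _] := chainY.
apply: bigcap_measurableType => i _; apply: bigcap_measurableType => j _.
apply: fin_bigcap_measurable => // s _.
by apply: measurableC; apply: measurableI.
Qed.

Lemma disjoint_pathsW m n w :
  (m <= n)%N -> disjoint_paths n w -> disjoint_paths m w.
Proof. by move=> mn dw i j im jm; apply: dw; apply: leq_trans mn. Qed.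

Lemma visited_meet t w :
  visited X t w `&` visited Y t w !=set0 <-> ~ disjoint_paths t w.
Proof.
split=> [[_ [[i /= it <-] [j /= jt]]] XY dw|].
  by apply: (dw i j it jt); rewrite XY.
move=> /existsNP[i] /existsNP[j] /not_implyP[it] /not_implyP[jt] /contrapT XY.
by exists (X i w); split; [exists i|exists j].
Qed.

(** The events [disjoint_paths n] decrease in [n] and hold exactly for [n < tau_I], so counting them
    gives [tau_I], including when it is infinite. *)
Lemma tau_I_series w :
  tau_I X Y w = (\sum_(n <oo) (\1_(disjoint_paths n) w)%:E)%E :> \bar R.
Proof.
have pos n : (0 <= (\1_(disjoint_paths n) w : R)%:E)%E by rewrite lee_fin.
have [[t0 ht0]|no] := pselect (exists t, ~ disjoint_paths t w); last first.
  have all_disj n : disjoint_paths n w by apply: contrapT => h; apply: no; exists n.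
  rewrite /tau_I (_ : [set t : nat | _] = set0) ?image_set0 ?ereal_inf0; last first.
    by apply/seteqP; split=> // t /visited_meet; apply.
  symmetry; apply: eq_infty => r.
  apply: (@le_trans _ _ ((Num.truncn r).+1%:R%:E)%E).
    by rewrite lee_fin ltW// truncnS_gt.
  apply: le_trans (nneseries_lim_ge (Num.truncn r).+1 _) => //.
  rewrite (eq_bigr (fun=> 1%:E)) => [|i _]; last first.
    by rewrite indicE mem_set.
  by rewrite sumEFin sumr_const_nat subn0.
have [|m /asboolP ndm mmin] := @ex_minnP (fun t => `[< ~ disjoint_paths t w >]).
  by exists t0; apply/asboolP.
have -> : tau_I X Y w = m%:R%:E :> \bar R.
  apply/eqP; rewrite eq_le; apply/andP; split.
    by apply: ereal_inf_lbound; exists m => //; apply/visited_meet.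
  apply: le_ereal_inf_tmp => _ [t /visited_meet ndt <-].
  by rewrite lee_fin ler_nat mmin//; apply/asboolP.
rewrite (nneseries_split 0 m)// add0n eseries0; last first.
  move=> i mi _; rewrite indicE memNset// => /(disjoint_pathsW mi) dm.
  exact: ndm dm.
rewrite adde0 (eq_big_nat _ _ (F2 := fun=> 1%:E)); last first.
  move=> i /andP[_ im]; rewrite indicE mem_set//; apply: contrapT => ndi.
  by move: im; rewrite ltnNge mmin//; apply/asboolP.
by rewrite sumEFin sumr_const_nat subn0.
Qed.

Lemma expected_tau_I :
  (\int[Pr]_w tau_I X Y w = \sum_(n <oo) Pr (disjoint_paths n))%E.
Proof.
under eq_integral do rewrite tau_I_series.
rewrite integral_nneseries//.
- apply: eq_eseriesr => n _; rewrite integral_indic ?setIT//.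
  exact: measurable_disjoint_paths.
- move=> n; apply/measurable_EFinP; apply: measurable_indic.
  exact: measurable_disjoint_paths.
Qed.


Lemma disjoint_paths_lower (D E : pred S) n :
  (forall s, D s -> E s -> False) ->
  ((stay_prob P D n x * stay_prob P E n y)%:E <= Pr (disjoint_paths n))%E.
Proof.
move=> DE; rewrite EFinM -(stay_law chainX) -(stay_law chainY).
rewrite -indep; [|exact: sigma_process_stay|exact: sigma_process_stay].
apply: le_measure; rewrite ?inE.
- by apply: measurableI; [exact: (measurable_stay chainX)|exact: (measurable_stay chainY)].
- exact: measurable_disjoint_paths.
- move=> w [Dw Ew] i j ni nj XY; apply: (DE (X i w)); first exact: Dw.
  by rewrite XY; exact: Ew.
Qed.

(** If both chains have visited [o] by time [n], their paths share [o]; the rest is a union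
    bound. *)
Lemma disjoint_paths_upper (o : S) n :
  (Pr (disjoint_paths n) <=
   (stay_prob P (predC1 o) n x + stay_prob P (predC1 o) n y)%:E)%E.
Proof.
rewrite EFinD -(stay_law chainX) -(stay_law chainY).
apply: (le_trans _ (measureU2 Pr (measurable_stay chainX _ _)
                               (measurable_stay chainY _ _))).
apply: le_measure; rewrite ?inE.
- exact: measurable_disjoint_paths.
- by apply: measurableU; [exact: (measurable_stay chainX)|exact: (measurable_stay chainY)].
- move=> w dw; apply: contrapT => /not_orP[/existsNP[i] /not_implyP[ni /negP]].
  rewrite negbK => /eqP Xo /existsNP[j] /not_implyP[nj /negP].
  by rewrite negbK => /eqP Yo; apply: (dw i j ni nj); rewrite Xo Yo.
Qed.

End Intersections.

(** * Mixing from intersections *)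

Section TimesInterface.
Context {R : realType} {S : finType}.
Implicit Types (P : S -> S -> R) (pi : S -> R).

(** The maximum has base value [0], hence the assumption on [a]. *)
Lemma tv_dist_le (mu nu : S -> R) (a : R) : 0 <= a ->
  reflect (forall A : {set S}, `|\sum_(x in A) mu x - \sum_(x in A) nu x| <= a)
          (tv_dist mu nu <= a).
Proof.
move=> a0; apply: (iffP idP) => [h A|h].
  by apply: le_trans h; apply: le_bigmax.
by apply: bigmax_le.
Qed.

Lemma mixedP P pi t (a : R) : 0 <= a ->
  reflect (forall x (A : {set S}),
            `|\sum_(y in A) step_prob P t x y - \sum_(y in A) pi y| <= a)
          (\big[Num.max/0]_(x : S) tv_dist (step_prob P t x) pi <= a).
Proof.
move=> a0; apply: (iffP idP) => [h x|h].
  by apply/tv_dist_le => //; apply: le_trans h; apply: le_bigmax.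
by apply: bigmax_le => // x _; apply/tv_dist_le.
Qed.

Lemma t_mix_le P pi t :
  (forall x (A : {set S}),
     `|\sum_(y in A) step_prob P t x y - \sum_(y in A) pi y| <= 1 / 4) ->
  (t_mix P pi <= t%:R%:E)%E.
Proof. by move=> h; apply: ereal_inf_lbound; exists t => //; apply/mixedP. Qed.

End TimesInterface.

(** * Time averages approach stationarity when paths are likely to meet *)

Section CesaroFromIntersections.
Context {R : realType} {S : finType}.
Variables (P : S -> S -> R) (pi : S -> R).
Hypotheses (Pst : stochastic P) (pist : stationary P pi).

Lemma stationary_cesaro L f : (0 < L)%N ->
  \sum_x pi x * act (time_average P L) f x = \sum_x pi x * f x.
Proof.
move=> L0; have [_ piP] := pist.
have step g : \sum_x pi x * act P g x = \sum_x pi x * g x.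
  under eq_bigr do rewrite /act mulr_sumr.
  rewrite exchange_big; apply: eq_bigr => y _ /=; rewrite -piP mulr_suml.
  by apply: eq_bigr => x _; rewrite mulrA.
have it k : \sum_x pi x * iter k (act P) f x = \sum_x pi x * f x.
  by elim: k => //= k IH; rewrite step.
under eq_bigr do rewrite act_cesaroE mulrA mulr_sumr.
rewrite -mulr_suml exchange_big /=; under eq_bigr do rewrite it.
by rewrite sumr_const card_ord -[X in X / _]mulr_natr mulfK// pnatr_eq0 -lt0n.
Qed.

(* Two chains that are confined, with non-negligible probability, to disjoint
   sublevel and superlevel sets of [f] do not meet. *)
Lemma cesaro_close_of_meeting (eta : R) L t :
  0 < eta -> eta <= 1 / 2 -> (0 < L)%N -> t%:R <= eta * L%:R ->
  (forall (D : pred S) x y,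
     stay_prob P D t x * stay_prob P (predC D) t y < eta * (eta / 2)) ->
  forall x (A : {set S}),
    \sum_(y in A) pi y - \sum_(y in A) time_average P L x y <= 4 * eta.
Proof.
move=> eta0 eta2 L0 tL meet x A; rewrite leNgt; apply/negP => far.
have [[pi0 pi1] _] := pist.
have L0' : 0 < L%:R :> R by rewrite ltr0n.
have [h [hE h01]] : exists h : S -> R, (forall g : S -> R,
    \sum_(y in A) g y = \sum_y g y * h y) /\ forall y, 0 <= h y <= 1.
  exists (fun y => (y \in A)%:R); split=> [g|y].
    rewrite big_mkcond; apply: eq_bigr => y _.
    by case: (y \in A); rewrite ?mulr1 ?mulr0.
  by rewrite ler0n lern1 leq_b1.
have avg01 (p : S -> R) : distribution_on p -> 0 <= \sum_y p y * h y <= 1.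
  move=> [p0 p1]; apply/andP; split.
    by apply: sumr_ge0 => z _; apply: mulr_ge0; last case/andP: (h01 z).
  rewrite -[leRHS]p1; apply: ler_sum => z _.
  by apply: ler_piMr; last case/andP: (h01 z).
pose f := act (time_average P L) h.
have f01 y : 0 <= f y <= 1 by apply: avg01; exact: cesaro_stochastic.
have it01 y : 0 <= iter L (act P) h y <= 1.
  by rewrite iter_actE; apply: avg01; exact: step_prob_stochastic.
have shift y : f y - L%:R^-1 <= act P f y <= f y + L%:R^-1.
  rewrite /f act_cesaro_shift//.
  have : - L%:R^-1 <= (iter L (act P) h y - h y) / L%:R <= L%:R^-1.
    rewrite ler_pdivrMr// ler_pdivlMr// mulNr mulVf ?gt_eqF//.
    by have := it01 y; have := h01 y; lra.
  lra.
rewrite !hE -[X in _ - X]/(f x) in far.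
set a := \sum_y pi y * h y in far.
have a1 : a <= 1 by case/andP: (avg01 pi (conj pi0 pi1)).
(* By stationarity [f] has mean [a] under [pi], so its maximum is at least [a]. *)
have [y fy] : exists y, a <= f y.
  exists [arg max_(y > x) f y]%O.
  rewrite /a -(stationary_cesaro h L0) -/f -[leRHS]mul1r -[in leRHS]pi1 mulr_suml.
  apply: ler_sum => z _; apply: ler_wpM2l => //.
  by case: arg_maxP => // i _; apply.
have tL' : t%:R * L%:R^-1 <= eta by rewrite ler_pdivrMr.
have Vge0 : 0 <= L%:R^-1 :> R by rewrite invr_ge0 ltW.
clearbody a f; clear tL it01 avg01 h01 hE.
have [fx0 _] := andP (f01 x).
(* Halfway into the gap of [4 * eta] between [f x] and [a]: on either side the drift over time [t]
   uses at most [eta] and leaves the margin [eta]. *)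
pose lam := a - 2 * eta.
have lamE : lam = a - 2 * eta by [].
clearbody lam.
pose D := [pred z | f z < lam].
have lam0 : 0 < lam by lra.
have sX : eta <= stay_prob P D t x.
  apply: (@le_trans _ _ (eta / lam)); first by rewrite ler_pdivlMr// ler_piMr//; lra.
  apply: (@stay_prob_lower _ _ P D f L%:R^-1 lam eta t x) => //.
  - by move=> z; case/andP: (f01 z).
  - by move=> z; case/andP: (shift z).
  - by move=> z; rewrite /D /= -leNgt.
  - lra.
have sY : eta / 2 <= stay_prob P (predC D) t y.
  apply: (@le_trans _ _ (eta / (1 - lam))).
    have : eta * (1 - lam) <= eta * 2 by apply: ler_wpM2l; lra.
    by move=> ?; rewrite ler_pdivlMr; lra.
  apply: (@stay_prob_lower _ _ P (predC D) (fun z => 1 - f z) L%:R^-1 (1 - lam) eta t y) => //.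
  - by move=> z; rewrite subr_ge0; case/andP: (f01 z).
  - move=> z; rewrite (actB P (fun=> 1)).
    have -> : act P (fun=> 1) z = 1.
      by rewrite /act; under eq_bigr do rewrite mulr1; case: (Pst z).
    by have := shift z; lra.
  - by move=> z; rewrite /D /= negbK => /ltW; rewrite lerD2l lerN2.
  - lra.
  - lra.
have := meet D x y; rewrite ltNge => /negP; apply.
by apply: ler_pM; [exact: ltW|lra|exact: sX|exact: sY].
Qed.

End CesaroFromIntersections.

(** * The mixing time is at most a multiple of the intersection time *)

Section MixingByIntersections.
Context {R : realType} {S : finType} {d : measure_display}
        {Omega : measurableType d}.
Variables (P : S -> S -> R) (pi : S -> R)
  (Prxy : S -> S -> probability Omega R) (X Y : nat -> Omega -> S).
Hypothesis indep : independent_chains P Prxy X Y.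

Lemma expected_tau_I_le_t_I x y :
  (\int[Prxy x y]_w tau_I X Y w <= t_I Prxy X Y)%E.
Proof.
rewrite /t_I; apply: le_trans (le_bigmax _ _ x) => /=.
exact: (le_bigmax _ (fun y => \int[Prxy x y]_w tau_I X Y w)%E y).
Qed.

(** Markov's inequality: the terms [0, ..., t] of the tail sum number [t + 1], and each is at least
    the last. *)
Lemma t_I_tail x y t :
  (t.+1%:R%:E * Prxy x y (disjoint_paths X Y t) <= t_I Prxy X Y)%E.
Proof.
have [cX cY iXY] := indep x y.
apply: le_trans (expected_tau_I_le_t_I x y); rewrite (expected_tau_I cX cY).
apply: le_trans (nneseries_lim_ge t.+1 _) => //.
apply: (@le_trans _ _ (\sum_(0 <= n < t.+1) Prxy x y (disjoint_paths X Y t))%E).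
  have fin := fin_num_measure (Prxy x y) _ (measurable_disjoint_paths cX cY t).
  by rewrite -(fineK fin) sumEFin sumr_const_nat subn0 -EFinM mulr_natl.
rewrite big_nat [leRHS]big_nat; apply: lee_sum => n /andP[_ nt].
apply: le_measure; rewrite ?inE.
- exact: measurable_disjoint_paths cX cY _.
- exact: measurable_disjoint_paths cX cY _.
- by move=> w; apply: disjoint_pathsW.
Qed.

(** Distinct starting points are disjoint paths at time [0]. The bound later absorbs the rounding of
    times to integers. *)
Lemma t_I_ge1 (x y : S) : x != y -> (1 <= t_I Prxy X Y)%E.
Proof.
move=> xy; apply: le_trans (t_I_tail x y 0); rewrite mul1e.
have [cX cY iXY] := indep x y.
apply: le_trans (@disjoint_paths_lower _ _ _ _ _ _ _ P x y cX cY iXY (pred1 x) (predC1 x) 0 _).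
  have sum1 z : \sum_w (z == w)%:R = 1 :> R.
    rewrite (bigD1 z)//= eqxx big1 ?addr0// => w.
    by rewrite eq_sym => /negbTE ->.
  by rewrite /stay_prob /= !sum1 eqxx eq_sym xy !mulr1.
by move=> s /= ->.
Qed.

Hypotheses (Plazy : is_lazy P) (Pstat : stationary P pi)
  (Pdb : detailed_balance P pi).

Lemma t_mix_le_t_I (eta : R) m :
  0 < eta -> 384 * eta <= 1 -> 1 <= eta * m%:R ->
  (t_mix P pi <= (2 * m%:R * (2 / eta ^+ 2 + 1))%:E * t_I Prxy X Y)%E.
Proof.
move=> eta0 eta1 meta.
have Pst := is_lazy_stochastic Plazy.
have [Q Qst PE] := Plazy.
have [pidist _] := Pstat.
have m1 : 1 <= m%:R :> R by apply: le_trans meta _; apply: ler_piMl => //; lra.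
(* Chosen so that a time beyond [K * t_I] brings the probability of disjoint paths below
   [eta * (eta / 2)]. *)
have [K KE] : exists K : R, K = 2 / eta ^+ 2 by exists (2 / eta ^+ 2).
have K0 : 0 < K by rewrite KE; apply: divr_gt0 => //; apply: exprn_gt0.
rewrite -KE; set C := 2 * _ * _.
have C0 : 0 < C by rewrite /C; apply: mulr_gt0; lra.
have [[x0 [y0 xy]]|single] := pselect (exists x y : S, x != y); last first.
  have all_eq (x y : S) : x = y.
    by apply: contrapT => /eqP xy; apply: single; exists x, y.
  have [x _|S0] := pickP (fun _ : S => true); last first.
    by case: pidist => _; rewrite big_pred0// => /esym /eqP; rewrite oner_eq0.
  apply: (@le_trans _ _ (0%N%:R)%:E).
    apply: t_mix_le => y A; rewrite -sumrB big1 ?normr0 ?divr_ge0// => z _.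
    rewrite /= (all_eq y z) eqxx.
    case: pidist => _ <-; rewrite (bigD1 z)//= big1 ?addr0 ?subrr// => w.
    by rewrite (all_eq w z) eqxx.
  apply: mule_ge0; first by rewrite lee_fin ltW.
  by apply: le_trans (t_I_tail x x 0); rewrite mul1e.
have TI1 := t_I_ge1 xy; set TI := t_I Prxy X Y in TI1 *.
case E : TI => [T| |]; first last.
- by move: TI1; rewrite E.
- by rewrite gt0_muley ?leey// lte_fin.
move: TI1; rewrite E lee_fin => T1.
have KT0 : 0 <= K * T by apply: mulr_ge0; lra.
have [t tT Tt] : exists2 t : nat, t%:R <= K * T & K * T < t.+1%:R.
  by exists (Num.truncn (K * T)); case/andP: (truncn_itv KT0).
have t1 : 0 < t.+1%:R :> R by rewrite ltr0n.
(* As [m >= 1 / eta], this gives [t <= eta * L], so the drift up to time [t] is at most [eta]. *)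
pose L := (m * t.+1)%N.
have L0 : (0 < L)%N by rewrite /L muln_gt0 andbT -(ltr0n R); lra.
have LE : L%:R = m%:R * t.+1%:R :> R by rewrite /L natrM.
clearbody L.
have close x (A : {set S}) :
    \sum_(y in A) pi y - \sum_(y in A) time_average P L x y <= 4 * eta.
  apply: (cesaro_close_of_meeting Pst Pstat eta0 (t := t)) => //; first lra.
    rewrite LE mulrA; apply: (@le_trans _ _ t.+1%:R); first by rewrite ler_nat.
    by apply: ler_peMl => //; exact: ltW.
  move=> D u v.
  have [cX cY iXY] := indep u v.
  have := t_I_tail u v t; rewrite -/TI E => tail.
  have low := @disjoint_paths_lower _ _ _ _ _ _ _ P u v cX cY iXY D (predC D) t.
  have {}low := low (fun s (Ds : D s) (nDs : ~~ D s) => negP nDs Ds).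
  have : t.+1%:R * (stay_prob P D t u * stay_prob P (predC D) t v) <= T.
    rewrite -lee_fin EFinM; apply: le_trans tail.
    by apply: lee_wpmul2l => //; rewrite lee_fin ltW.
  rewrite -ler_pdivlMl// => /le_lt_trans; apply.
  rewrite mulrC ltr_pdivrMr//.
  have -> : eta * (eta / 2) = K^-1 by rewrite KE; field; rewrite gt_eqF.
  by rewrite mulrC ltr_pdivlMr// mulrC.
(* Here [2L = 2m (t + 1) <= 2m (K T + 1) <= 2m (K + 1) T], the last step because [T >= 1]. *)
apply: (@le_trans _ _ ((L + L)%:R%:E)); last first.
  rewrite -EFinM lee_fin natrD LE -natr1 /C.
  have h : m%:R * (t%:R + 1) <= m%:R * ((K + 1) * T) by apply: ler_wpM2l; lra.
  by apply: (@le_trans _ _ (2 * (m%:R * ((K + 1) * T)))); [lra|rewrite !mulrA].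
apply: t_mix_le => x A.
have [pi0 pi1] := pidist.
set a := \sum_(y in A) pi y.
have a01 : 0 <= a <= 1.
  rewrite /a sumr_ge0//= -pi1 [leRHS](bigID (mem A)) /= lerDl.
  by apply: sumr_ge0.
pose g (y : S) : R := (y \in A)%:R - a.
have g1 y : `|g y| <= 1.
  by rewrite ler_norml /g; case: (y \in A) => /=; lra.
have sumA (p : S -> R) : \sum_y p y * (y \in A)%:R = \sum_(y in A) p y.
  rewrite [RHS]big_mkcond; apply: eq_bigr => y _.
  by case: (y \in A); rewrite ?mulr1 ?mulr0.
have g0 : \sum_y pi y * g y = 0.
  under eq_bigr do rewrite mulrBr.
  by rewrite sumrB sumA -mulr_suml pi1 mul1r subrr.
have := lazy_mixing Qst PE pidist Pdb L0 close g1 g0 x.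
rewrite iter_actE; under eq_bigr do rewrite mulrBr.
rewrite sumrB sumA -mulr_suml (step_prob_stochastic _ Pst x).2 [1 * a]mul1r.
(* With [delta = 4 * eta] the bound is [1/16 + 72 * eta], at most [1/4] when [384 * eta <= 1]. *)
move=> h; apply: (le_trans h); lra.
Qed.

End MixingByIntersections.

(** * Trees *)

Section Avoiding.
Context {V : finType}.
Implicit Types (e : rel V).

(** Its connected components other than [o] itself are the branches at [o]. *)
Definition avoiding e (o : V) : rel V :=
  [rel a b | [&& e a b, a != o & b != o]].

Lemma avoiding_sym e o : symmetric e -> symmetric (avoiding e o).
Proof. by move=> es a b; rewrite /avoiding /= es; congr (_ && _); rewrite andbC. Qed.

Lemma connect_avoiding_neq e o x y :
  x != o -> connect (avoiding e o) x y -> y != o.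
Proof.
move=> xo /connectP[p + ->]; elim: p x xo => //= a p IH x xo.
by move=> /andP[/and3P[_ _ ao]]; exact: IH.
Qed.

Lemma last_step_before e o x : x != o -> connect e x o ->
  exists2 u, connect (avoiding e o) x u & e u o.
Proof.
move=> xo /connectP[p]; elim: p x xo => [|y p IH] x xo /=.
  by move=> _ ox; rewrite ox eqxx in xo.
move=> /andP[exy yp] lo; have [yo|yo] := eqVneq y o; first by exists x; rewrite -?yo.
have [u yu uo] := IH y yo yp lo; exists u => //.
by apply: connect_trans yu; apply: connect1; rewrite /avoiding /= exy xo yo.
Qed.

(** The path off [u] never meets [o], since otherwise its initial part would connect [w] to [o] off
    [u]. *)
Lemma connect_avoiding_switch e o u w v :
  w != o -> ~~ connect (avoiding e u) w o ->
  connect (avoiding e u) w v -> connect (avoiding e o) w v.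
Proof.
move=> wo nwo /connectP[p + ->]; elim: p w wo nwo => //= a p IH w wo nwo.
move=> /andP[wa ap]; have wa' : connect (avoiding e u) w a by apply: connect1.
have ao : a != o by apply: contraNneq nwo => <-.
apply: (connect_trans _ (IH a ao _ ap)).
  by apply: connect1; case/and3P: wa => ewa _ _; rewrite /avoiding /= ewa wo ao.
by apply: contra nwo; apply: connect_trans.
Qed.

(** A branch is attached to [o] by one edge only: a simple path off [o] between two distinct
    neighbours of [o] would close up into a cycle through [o]. *)
Lemma acyclic_branch e o u v :
  symmetric e -> irreflexive e ->
  (forall s : seq V, (2 < size s)%N -> ~ ucycle e s) ->
  e o u -> e o v -> connect (avoiding e o) u v -> u = v.
Proof.
move=> es ei acyc ou ov /connectP[p0 p0P vE]; move: vE.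
case: (shortenP p0P) => p pP pU _ vE; apply: contrapT => uv.
apply: (acyc (o :: u :: p)).
  by case: p vE {pP pU} => //= vu; move: uv; rewrite vu.
have uo : u != o by apply/eqP => uo; move: ou; rewrite uo ei.
have op : o \notin p.
  clear -uo pP; elim: p u uo pP => //= a p IH u uo /andP[/and3P[_ _ ao] ap].
  by rewrite inE negb_or eq_sym ao /=; exact: IH ap.
rewrite /ucycle; apply/andP; split; last first.
  by rewrite [uniq _]/= inE negb_or eq_sym uo op.
rewrite /= ou rcons_path -vE es ov andbT.
by apply: sub_path pP => a b /and3P[].
Qed.

End Avoiding.

(** * Existence of a centroid for a mass distribution on a tree *)

Section Centroid.
Context {R : realType} {V : finType}.
Variables (e : rel V) (pi : V -> R).
Hypotheses (treee : is_tree e) (pidist : distribution_on pi).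

(* A branch of minimal size among those of mass [> 1/2] is contradictory: its
   vertex adjacent to the removed one has a strictly smaller heavy branch. *)
Lemma tree_centroid : exists o, forall x, x != o ->
  \sum_(z | connect (avoiding e o) x z) pi z <= 1 / 2.
Proof.
have [V0 es ei conn acyc] := treee.
have [pi0 pi1] := pidist.
apply: contrapT => no.
have heavy o : exists2 x, x != o & 1 / 2 < \sum_(z | connect (avoiding e o) x z) pi z.
  apply: contrapT => nx; apply: no; exists o => x xo.
  by rewrite leNgt; apply/negP => h; apply: nx; exists x.
have csym o := sym_connect_sym (avoiding_sym o es).
suff descent : forall n o x, x != o -> 1 / 2 < \sum_(z | connect (avoiding e o) x z) pi z ->
    (#|connect (avoiding e o) x| <= n)%N -> False.
  have /card_gt0P[v _] := V0; have [x xv hx] := heavy v.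
  exact: (descent _ v x xv hx (leqnn _)).
elim=> [|n IH] o x xo hx.
  rewrite leqn0 => /eqP /card0_eq /(_ x).
  by have : x \in connect (avoiding e o) x by [exact: connect0] => ->.
move=> cn; have [u xu uo] := last_step_before xo (conn x o).
have [x' x'u hx'] := heavy u.
(* Two sets of mass above [1/2] must intersect. *)
have [w xw x'w] : exists2 w, connect (avoiding e o) x w & connect (avoiding e u) x' w.
  apply: contrapT => dis.
  have : \sum_(z | connect (avoiding e o) x z) pi z
       + \sum_(z | connect (avoiding e u) x' z) pi z <= \sum_z pi z.
    rewrite [leRHS](bigID (connect (avoiding e o) x)) /= lerD2l.
    rewrite [leRHS](bigID (connect (avoiding e u) x')) /=.
    rewrite (eq_bigl (fun z => ~~ connect (avoiding e o) x z && connect (avoiding e u) x' z)).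
      by rewrite lerDl sumr_ge0.
    move=> z; case: (boolP (connect (avoiding e u) x' z)) => c; last by rewrite andbF.
    by rewrite andbT; symmetry; apply/negP => c'; apply: dis; exists z.
  by rewrite pi1; lra.
have wo := connect_avoiding_neq xo xw.
(* Otherwise [o] would be entered from a neighbour [v1] other than [u] in the same branch at [o]. So
   the heavy branch at [u] lies inside the one at [o], and it lacks [u]. *)
have nwo : ~~ connect (avoiding e u) w o.
  apply/negP => /(last_step_before wo)[v1 wv1 /and3P[ev1 v1u _]].
  have v1o : v1 != o by apply/negP => /eqP v1o; rewrite v1o ei in ev1.
  have wv1' : connect (avoiding e o) w v1.
    apply: connect_sub wv1 => a b /and3P[/and3P[ab _ _] ao bo].
    by apply: connect1; rewrite /avoiding /= ab ao bo.
  have uv1 : u = v1.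
    apply: (@acyclic_branch _ e o) => //; rewrite 1?es//.
    apply: connect_trans wv1'; rewrite csym; apply: connect_trans xu.
    by rewrite csym.
  by rewrite uv1 eqxx in v1u.
have sub z : connect (avoiding e u) x' z -> connect (avoiding e o) x z.
  move=> x'z; apply: (connect_trans xw).
  apply: (@connect_avoiding_switch _ e o u) => //.
  by apply: connect_trans x'z; rewrite csym.
apply: (IH u x' x'u hx'); rewrite -ltnS; apply: leq_trans cn.
apply: proper_card; apply/properP; split; first by apply/fintype.subsetP => z; exact: sub.
exists u => //; apply/negP => /(connect_avoiding_neq x'u).
by rewrite eqxx.
Qed.

End Centroid.

(** * Hitting the centroid by a weighted walk on a tree *)

Section TreeWalk.
Context {R : realType} {V : finType}.
Variables (e : rel V) (wt : V -> V -> R).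
Hypotheses (treee : is_tree e) (ewt : edge_weights e wt).

Let deg v := \sum_(w | e v w) wt v w.

Let wt_ge0 u v : e u v -> 0 <= wt u v. Proof. by move=> /ewt[/ltW]. Qed.

Lemma tree_neighbour v : #|V| != 1%N -> exists w, e v w.
Proof.
have [V0 _ _ conn _] := treee => V1.
have : (1 < #|V|)%N by rewrite ltn_neqAle eq_sym V1.
move=> /card_gt1P[a [b [_ _ ab]]].
have [w wv] : exists w, w != v.
  by have [av|] := eqVneq a v; [exists b; rewrite -av eq_sym|exists a].
have /connectP[[|u p] /=] := conn v w.
  by move=> _ wv'; rewrite wv' eqxx in wv.
by move=> /andP[vu _] _; exists u.
Qed.

Lemma deg_gt0 v : #|V| != 1%N -> 0 < deg v.
Proof.
move=> /(tree_neighbour v)[w vw]; rewrite /deg (bigD1 w)//=.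
apply: ltr_wpDr; last by case: (ewt vw).
by apply: sumr_ge0 => u /andP[/wt_ge0].
Qed.

Lemma weighted_walk_stochastic : stochastic (weighted_walk e wt).
Proof.
move=> u; rewrite /weighted_walk; case: (boolP (#|V| == 1%N)) => V1.
  split=> [v|]; first by rewrite ler0n.
  rewrite (bigD1 u)//= eqxx big1 ?addr0// => v.
  by rewrite eq_sym => /negbTE ->.
have du := deg_gt0 u V1; split=> [v|].
  by case: ifP => // /wt_ge0 w0; rewrite divr_ge0// ltW.
by rewrite -big_mkcond -mulr_suml divff// gt_eqF.
Qed.

Let P := lazy_version (weighted_walk e wt).

Lemma lazy_walk_edge a b : P a b != 0 -> (a == b) || e a b.
Proof.
rewrite /P /lazy_version /weighted_walk; case: (a == b) => //=.
by case: ifP => _; [|case: (e a b) => //]; rewrite addr0 mul0r eqxx.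
Qed.

(* [pi / deg] is harmonic, hence constant by the maximum principle. *)
Lemma tree_detailed_balance pi : stationary P pi -> detailed_balance P pi.
Proof.
have [V0 es ei conn _] := treee.
move=> [_ statP]; case: (boolP (#|V| == 1%N)) => V1.
  move=> x y; suff -> : x = y by [].
  by have /card_le1_eqP := eq_leq (eqP V1); apply.
pose h v := pi v / deg v.
have piE v : pi v = h v * deg v by rewrite /h divfK// gt_eqF// deg_gt0.
have statQ y : \sum_x pi x * weighted_walk e wt x y = pi y.
  have := statP y; rewrite /P /lazy_version.
  under eq_bigr do rewrite mulrA mulrDr.
  rewrite -mulr_suml big_split /= (_ : \sum_x pi x * (x == y)%:R = pi y); first lra.
  rewrite (bigD1 y)//= eqxx mulr1 big1 ?addr0// => x /negbTE ->.
  by rewrite mulr0.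
have harm y : \sum_(x | e y x) wt y x * (h y - h x) = 0.
  under eq_bigr do rewrite mulrBr.
  rewrite sumrB -mulr_suml -/(deg y) [deg y * _]mulrC -piE -statQ; apply/eqP.
  rewrite subr_eq0; apply/eqP; rewrite [RHS]big_mkcond; apply: eq_bigr => x _.
  rewrite /weighted_walk (negbTE V1) (es y x); case: ifP => exy; last by rewrite mulr0.
  by rewrite piE (ewt exy).2 -/(deg x); field; rewrite gt_eqF// deg_gt0.
have /card_gt0P[v0 _] := V0.
pose m := [arg max_(y > v0) h y]%O.
have hm x : h x <= h m by rewrite /m; case: arg_maxP => // i _; apply.
have const x : h x = h m.
  have /connectP[p + ->] := conn m x.
  suff : forall y, h y = h m -> path e y p -> h (last y p) = h m by apply.
  elim: p => //= a p IH y hy /andP[ya ap]; apply: IH => //.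
  have /eqP := harm y; rewrite psumr_eq0 => [|z yz]; last first.
    by rewrite mulr_ge0 ?wt_ge0// subr_ge0 hy.
  move=> /allP/(_ a); rewrite mem_index_enum ya => /(_ isT)/implyP/(_ isT).
  have [wya _] := ewt ya.
  by rewrite mulf_eq0 gt_eqF//= subr_eq0 => /eqP <-.
move=> x y; rewrite /P /lazy_version; case: (eqVneq x y) => [->//|xy].
rewrite !addr0 /weighted_walk (negbTE V1) (es y x); case: ifP => exy; last first.
  by rewrite !mul0r !mulr0.
rewrite !piE !const (ewt exy).2 -/(deg x) -/(deg y).
by field; rewrite !gt_eqF ?deg_gt0.
Qed.

Variables (pi : V -> R) (t : nat).
Hypotheses (Pstat : stationary P pi)
  (mixed : forall x (A : {set V}),
     `|\sum_(y in A) step_prob P t x y - \sum_(y in A) pi y| <= 1 / 4).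

Let Pst : stochastic P.
Proof. by apply: lazy_stochastic; exact: weighted_walk_stochastic. Qed.

Let P_ge0 x y : 0 <= P x y. Proof. by case: (Pst x). Qed.

(** Killed at [o], the chain cannot leave the branch of [x], so the surviving mass is at most the
    probability of that branch at time [t], that is at most [1/2 + 1/4]. *)
Lemma killed_mass_le o x : x != o ->
  \sum_(z | connect (avoiding e o) x z) pi z <= 1 / 2 ->
  \sum_z step_prob (killed P (predC1 o)) t x z <= 3 / 4.
Proof.
move=> xo half; pose B := [set z | connect (avoiding e o) x z].
have supp n z : z \notin B -> step_prob (killed P (predC1 o)) n x z = 0.
  elim: n z => [|n IH] z zB /=.
    case: eqVneq => // xz; move: zB; rewrite inE -xz.
    by rewrite connect0.
  apply: big1 => w _; have [wB|wB] := boolP (w \in B); last by rewrite IH ?mul0r.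
  rewrite /killed; have [zo|zo] := eqVneq z o; first by rewrite /= zo eqxx !mulr0.
  have [->|/lazy_walk_edge] := eqVneq (P w z) 0; first by rewrite mul0r mulr0.
  case: eqVneq => [wz|_ /= ewz]; first by rewrite wz (negbTE zB) in wB.
  move: wB zB; rewrite !inE => xw /negP[].
  apply: (connect_trans xw); apply: connect1.
  by rewrite /avoiding /= ewz zo (connect_avoiding_neq xo xw).
rewrite (bigID (mem B)) /= [X in _ + X]big1 ?addr0 => [|z]; last exact: supp.
apply: (@le_trans _ _ (\sum_(z in B) step_prob P t x z)).
  apply: ler_sum => z _; move: z; elim: t => //= n IH z.
  apply: ler_sum => w _; apply: ler_pM => //.
  - by apply: step_prob_ge0; apply: killed_ge0.
  - exact: killed_ge0.
  - by rewrite /killed ler_piMr// lern1 leq_b1.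
have := mixed x B; have : \sum_(y in B) pi y <= 1 / 2.
  by rewrite (eq_bigl (connect (avoiding e o) x)) // => z; rewrite inE.
by rewrite ler_norml; lra.
Qed.

(** Survival shrinks by [3/4] every [t] steps, so the partial sum [S] satisfies [S <= t + 3/4 * S];
    working with finite [N] allows solving for [S]. *)
Lemma tree_stay_sum_le o x N :
  (forall y, y != o -> \sum_(z | connect (avoiding e o) y z) pi z <= 1 / 2) ->
  \sum_(n < N) stay_prob P (predC1 o) n x <= 4 * t%:R.
Proof.
move=> cent; pose s n := stay_prob P (predC1 o) n x.
pose K := killed P (predC1 o).
have K0 a b : 0 <= K a b by apply: killed_ge0.
have s_ge0 n : 0 <= s n.
  by rewrite mulr_ge0// sumr_ge0// => z _; apply: step_prob_ge0.
have decay n : s (n + t)%N <= 3 / 4 * s n.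
  rewrite /s /stay_prob mulrCA !mulr_sumr -/K.
  under eq_bigr do rewrite step_probD mulr_sumr.
  rewrite exchange_big /=; apply: ler_sum => w _.
  (* [killed_mass_le] applies off [o] only; at [o] the killed chain carries no mass. *)
  have [->|wo] := eqVneq w o; last first.
    rewrite -mulr_sumr ler_wpM2l// -mulr_sumr mulrC ler_wpM2r//.
      exact: step_prob_ge0.
    exact: killed_mass_le (cent w wo).
  have z0 : (predC1 o x)%:R * step_prob K n x o = 0.
    case: n => [|n] /=.
      by case: eqVneq => xo /=; rewrite ?mul0r ?mulr0.
    by rewrite big1 ?mulr0// => z _; rewrite /K /killed /= eqxx !mulr0.
  rewrite mulrCA z0 mulr0 big1 // => z _.
  by rewrite mulrA z0 mul0r.
have s_le1 n : s n <= 1.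
  elim: n => [|n IH].
    rewrite /s /stay_prob /= (bigD1 x)//= eqxx big1 ?addr0 ?mulr1 ?lern1 ?leq_b1//.
    by move=> z; rewrite eq_sym => /negbTE ->.
  apply: le_trans IH; rewrite /s /stay_prob ler_wpM2l// exchange_big /=.
  apply: ler_sum => w _; rewrite -mulr_sumr ler_piMr ?step_prob_ge0//.
  rewrite -[leRHS](Pst w).2; apply: ler_sum => z _.
  by rewrite /killed ler_piMr// lern1 leq_b1.
have head : \sum_(n < t) s n <= t%:R.
  rewrite -[X in X%:R]card_ord -sum1_card natr_sum.
  by apply: ler_sum.
have shift : \sum_(n < N) s n <= \sum_(n < t) s n + \sum_(n < N) s (n + t)%N.
  apply: (@le_trans _ _ (\sum_(n < t + N) s n)).
    by rewrite addnC big_split_ord /= lerDl sumr_ge0.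
  by rewrite big_split_ord /= lerD2l; apply: ler_sum => n _; rewrite addnC.
have : \sum_(n < N) s (n + t)%N <= 3 / 4 * \sum_(n < N) s n.
  by rewrite mulr_sumr; apply: ler_sum => n _; exact: decay.
lra.
Qed.

Lemma tree_t_I_le (d : measure_display) (Omega : measurableType d)
    (Prxy : V -> V -> probability Omega R) (X Y : nat -> Omega -> V) :
  independent_chains P Prxy X Y -> (t_I Prxy X Y <= (8 * t%:R)%:E)%E.
Proof.
move=> indep; have [pidist _] := Pstat.
have [r cent] := tree_centroid treee pidist.
apply: bigmax_le => [|x _]; first by rewrite leNye.
apply: bigmax_le => [|y _]; first by rewrite leNye.
have [cX cY _] := indep x y.
rewrite (expected_tau_I cX cY); apply: lime_le.
  exact: is_cvg_nneseries.
near=> N.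
apply: (@le_trans _ _ (\sum_(0 <= n < N)
    (stay_prob P (predC1 r) n x + stay_prob P (predC1 r) n y)%:E)%E).
  by apply: lee_sum => n _; exact: disjoint_paths_upper.
rewrite sumEFin lee_fin big_mkord big_split /=.
have := tree_stay_sum_le x N cent; have := tree_stay_sum_le y N cent; lra.
Unshelve. all: by end_near.
Qed.

End TreeWalk.

Theorem corollary1p2 (R : realType) :
  (exists C : R, 0 < C /\
     forall (S : finType) (P : S -> S -> R) (pi : S -> R),
       is_lazy P -> irreducible_chain P ->
       stationary P pi -> detailed_balance P pi ->
     forall (d : measure_display) (Omega : measurableType d)
       (Prxy : S -> S -> probability Omega R) (X Y : nat -> Omega -> S),
       independent_chains P Prxy X Y ->
       (t_mix P pi <= C%:E * t_I Prxy X Y)%E)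
  /\
  (exists c C : R, [/\ 0 < c, 0 < C &
     forall (V : finType) (e : rel V) (wt : V -> V -> R) (pi : V -> R),
       is_tree e -> edge_weights e wt ->
       let P := lazy_version (weighted_walk e wt) in
       stationary P pi ->
     forall (d : measure_display) (Omega : measurableType d)
       (Prxy : V -> V -> probability Omega R) (X Y : nat -> Omega -> V),
       independent_chains P Prxy X Y ->
       (c%:E * t_I Prxy X Y <= t_mix P pi)%E /\
       (t_mix P pi <= C%:E * t_I Prxy X Y)%E]).
Proof.
have [C [C0 CP]] : exists C : R, 0 < C /\
    forall (S : finType) (P : S -> S -> R) (pi : S -> R),
      is_lazy P -> stationary P pi -> detailed_balance P pi ->
    forall (d : measure_display) (Omega : measurableType d)
      (Prxy : S -> S -> probability Omega R) (X Y : nat -> Omega -> S),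
      independent_chains P Prxy X Y ->
      (t_mix P pi <= C%:E * t_I Prxy X Y)%E.
  have [eta [eta0 eta1]] : exists eta : R, 0 < eta /\ 384 * eta = 1.
    by exists (1 / 384); split; lra.
  (* The instance [m = 384 = 1 / eta] of [t_mix_le_t_I]. *)
  exists (2 * 384%N%:R * (2 / eta ^+ 2 + 1)); split.
    apply: mulr_gt0; first lra.
    by apply: addr_gt0; [apply: divr_gt0; [|exact: exprn_gt0]|].
  move=> S P pi Plazy Pstat Pdb d Omega Prxy X Y indep.
  by apply: (t_mix_le_t_I indep Plazy Pstat Pdb eta0); lra.
split; first by exists C; split=> // S P pi Plazy _; exact: CP.
exists 8^-1, C; split=> //.
move=> V e wt pi treee ewt P Pstat d Omega Prxy X Y indep; split.
  (* Every mixed time [t] is bounded below, which bounds the infimum, also when it is [+oo]. *)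
  apply: le_ereal_inf_tmp => _ [t /= mix <-].
  have mixed : forall x (A : {set V}),
     `|\sum_(y in A) step_prob P t x y - \sum_(y in A) pi y| <= 1 / 4.
    by apply/mixedP; [exact: divr_ge0|exact: mix].
  have tI := tree_t_I_le treee ewt Pstat mixed indep.
  rewrite muleC lee_pdivrMr// -EFinM mulrC; exact: tI.
apply: CP => //; last exact: tree_detailed_balance.
exists (weighted_walk e wt) => //; exact: weighted_walk_stochastic.
Qed.
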